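(* Let $\mathcal{D}=(S,\mathbf{P},s_I,\rho)$ be a Markov chain, $G\subseteq S$ a set of absorbing goal states with $\Pr(\lozenge G)=1$, and $S_?=S\setminus G$. Let $k\ge 0$ be such that $\Pr_s(\square^{\le k} S_?)<1$ for all $s\in S_?$. Then \begin{align*} &\mathbb{E}(\mathrm{Rew}^{\le k}_G) + \Pr(\square^{\le k} S_?)\cdot \min_{s\in S_?} \frac{\mathbb{E}_s(\mathrm{Rew}^{\le k}_G)}{1-\Pr_s(\square^{\le k} S_?)}\\ \le\ & \mathbb{E}(\mathrm{Rew}_G)\\ \le\ & \mathbb{E}(\mathrm{Rew}^{\le k}_G) + \Pr(\square^{\le k} S_?)\cdot \max_{s\in S_?} \frac{\mathbb{E}_s(\mathrm{Rew}^{\le k}_G)}{1-\Pr_s(\square^{\le k} S_?)}. \end{align*}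
   Context: $\mathcal{D}$ has finite state set $S$, initial state $s_I$, transition probabilities $\mathbf{P}(s,s')$, and reward function $\rho\colon S\to\mathbb{R}$ (rewards may be negative). $\Pr_s$ and $\mathbb{E}_s$ denote the probability measure and expectation on paths starting in $s$; without subscript they refer to the initial state $s_I$. For a path $\pi=s_0s_1s_2\dots$ that reaches $G$ and $k\in\mathbb{N}\cup\{\infty\}$, the $k$-bounded reachability reward is $\mathrm{Rew}^{\le k}_G(\pi)=\sum_{i=0}^{j-1}\rho(s_i)$ with $j=\min(\{i\ge0\mid s_i\in G\}\cup\{k\})$, and $\mathrm{Rew}_G=\mathrm{Rew}^{\le\infty}_G$ (the reward accumulated until reaching $G$); $\mathbb{E}(\mathrm{Rew}_G)$ is the expected reachability reward. $\lozenge G$ is the set of paths eventually reaching $G$, and $\square^{\le k} S_?$ is the set of paths whose first $k$ steps stay in $S_?$, i.e. the complement of the paths reaching $S\setminus S_?$ within at most $k$ steps. *)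

(* Defs.v *)
From HB Require Import structures.
From mathcomp Require Import all_boot all_order all_algebra.
From mathcomp Require Import all_classical all_reals all_analysis.
From mathcomp Require Import ring lra.

Set Implicit Arguments.
Unset Strict Implicit.
Unset Printing Implicit Defensive.

Import Order.TTheory GRing.Theory Num.Theory.
Import numFieldNormedType.Exports.

Local Open Scope classical_set_scope.
Local Open Scope ring_scope.

Record markov_chain (R : realType) (S : finType) := MarkovChain {
  trans : S -> S -> R;
  init : S;
  reward : S -> R;
  trans_ge0 : forall s t, 0 <= trans s t;
  trans_sum1 : forall s, \sum_t trans s t = 1 }.

Definition absorbing (R : realType) (S : finType) (D : markov_chain R S)
  (s : S) : Prop := trans D s s = 1.

(* The argument [D] only serves to point the type, which the measurable types
   of the library require. *)
Definition trajectory (R : realType) (S : finType) (D : markov_chain R S) : Type :=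
  nat -> S.

HB.instance Definition _ (R : realType) (S : finType) (D : markov_chain R S) :=
  Choice.copy (trajectory D) (nat -> S).
HB.instance Definition _ (R : realType) (S : finType) (D : markov_chain R S) :=
  isPointed.Build (trajectory D) (fun=> init D).

Section path_space.
Context (R : realType) (S : finType) (D : markov_chain R S).

Definition cylinder (n : nat) (x : nat -> S) : set (trajectory D) :=
  [set w | forall i, (i <= n)%N -> w i = x i].

Definition cylinders : set (set (trajectory D)) :=
  [set A | exists n x, A = cylinder n x].

Definition paths := g_sigma_algebraType cylinders.

(* By Dynkin's pi-lambda theorem at most one probability measure satisfies this
   condition; existence is [path_measure_exists]. *)
Definition is_path_measure (s : S) (P : probability paths R) : Prop :=
  forall n x, P (cylinder n x) =
    ((x 0 == s)%:R * \prod_(i < n) trans D (x i) (x i.+1))%:E.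

(* Existence: the law of the path obtained from a uniform point [u] of [0, 1[ by
   repeatedly splitting the interval proportionally to the transition
   probabilities and rescaling the piece that contains [u]. *)

Let cum (s : S) (j : nat) : R := \sum_(r <- take j (enum S)) trans D s r.

Let cumS (s t : S) :
  cum s (index t (enum S)).+1 = cum s (index t (enum S)) + trans D s t.
Proof.
rewrite /cum (take_nth t) ?index_mem ?mem_enum// nth_index ?mem_enum//.
by rewrite -cats1 big_cat/= big_seq1.
Qed.

Let cum_le s i j : (i <= j)%N -> cum s i <= cum s j.
Proof.
move=> ij; rewrite /cum -(subnKC ij) takeD big_cat/= lerDl.
by apply: sumr_ge0 => r _; exact: trans_ge0.
Qed.

Let cum0 s : cum s 0 = 0. Proof. by rewrite /cum take0 big_nil. Qed.

Let cum1 s : cum s #|S| = 1.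
Proof. by rewrite /cum cardE take_size big_enum trans_sum1. Qed.

Let low (s t : S) : R := cum s (index t (enum S)).

Let low_ge0 s t : 0 <= low s t.
Proof. by rewrite -(cum0 s) cum_le. Qed.

Let low_le1 s t : low s t + trans D s t <= 1.
Proof. by rewrite /low -cumS -(cum1 s) cum_le// cardE index_mem mem_enum. Qed.

Let inpiece (s : S) (u : R) (t : S) : bool :=
  (low s t <= u) && (u < low s t + trans D s t).

Let inpiece_uniq s u t t' : inpiece s u t -> inpiece s u t' -> t = t'.
Proof.
move=> /andP[a b] /andP[c d].
have [//|tt'] := eqVneq t t'.
have {tt'} : index t (enum S) != index t' (enum S).
  apply: contra_neq tt' => e.
  by rewrite -(nth_index t (mem_enum S t)) e nth_index ?mem_enum.
rewrite neq_ltn => /orP[] /(cum_le s); rewrite cumS -!/(low _ _) => h; exfalso; lra.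
Qed.

Let inpiece_ex s u : 0 <= u -> u < 1 -> exists t, inpiece s u t.
Proof.
move=> u0 u1.
have ex : exists j, u < cum s j by exists #|S|; rewrite cum1.
case: (ex_minnP ex) => -[|j] uj jmin; first by move: uj; rewrite cum0 ltNge u0.
have cj : cum s j <= u.
  by rewrite leNgt; apply/negP => /jmin; rewrite ltnn.
have jS : (j < #|S|)%N by apply: jmin; rewrite cum1.
have jE : (j < size (enum S))%N by rewrite -cardE.
exists (nth s (enum S) j); rewrite /inpiece -cumS /low.
by rewrite index_uniq ?enum_uniq// cj uj.
Qed.

Let step (su : S * R) : S * R :=
  let t := odflt su.1 [pick t | inpiece su.1 su.2 t] in
  (t, (su.2 - low su.1 t) / trans D su.1 t).

Let decode (s : S) (u : R) : trajectory D := fun n => (iter n step (s, u)).1.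

Let decodeS s u t n : inpiece s u t ->
  decode s u n.+1 = decode t ((u - low s t) / trans D s t) n.
Proof.
move=> ut; rewrite /decode iterSr; congr (iter _ _ _).1.
rewrite /step/=; case: pickP => /= [t' ut'|/(_ t)]; last by rewrite ut.
by rewrite (inpiece_uniq ut' ut).
Qed.

Let decode_cyl s n x : x 0%N = s ->
  exists a, [/\ 0 <= a, a + \prod_(i < n) trans D (x i) (x i.+1) <= 1 &
    forall u, 0 <= u -> u < 1 -> cylinder n x (decode s u) <->
      a <= u < a + \prod_(i < n) trans D (x i) (x i.+1)].
Proof.
elim: n s x => [|n IH] s x x0.
  exists 0; rewrite big_ord0 add0r; split=> // u u0 u1; rewrite u0 u1; split=> //.
  by move=> _ [|//] _; rewrite /decode/= x0.
rewrite big_ord_recl/= x0.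
have [a' [a'0 a'1 Ha']] := IH (x 1%N) (fun i => x i.+1) erefl.
set w' := \prod_(i < n) _ in a'1 Ha'.
have -> : \prod_(i < n) trans D (x (bump 0 i)) (x (bump 0 i).+1) = w'.
  by apply: eq_bigr => i _; rewrite /bump leq0n.
have w'0 : 0 <= w' by apply: prodr_ge0 => i _; exact: trans_ge0.
set t := x 1%N in Ha' *; set p := trans D s t.
have p0 : 0 <= p := trans_ge0 D s t.
have l0 := low_ge0 s t; have l1 : low s t + p <= 1 := low_le1 s t.
exists (low s t + p * a'); split.
- by rewrite addr_ge0// mulr_ge0.
- by apply: le_trans l1; rewrite -addrA lerD2l -mulrDr ler_piMr.
move=> u u0 u1.
have cylP : cylinder n.+1 x (decode s u) <->
    inpiece s u t /\ cylinder n (fun i => x i.+1) (decode t ((u - low s t) / p)).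
  split=> [h|[ut h] [|i] ilen]; last 2 first.
  - by rewrite x0.
  - by rewrite (decodeS _ ut) h.
  have [t' ut'] := inpiece_ex s u0 u1.
  have t't : t' = t by rewrite /t -h// (decodeS _ ut').
  rewrite t't in ut'; split=> // i ilen.
  by rewrite -(decodeS _ ut') h.
rewrite cylP /inpiece -/p.
have [p00|pn0] := eqVneq p 0.
  rewrite p00 !mul0r !addr0; split; last by case/andP; lra.
  by move=> [/andP[? ?]]; lra.
have pp : 0 < p by rewrite lt0r pn0.
have Hu' : low s t <= u -> u < low s t + p -> 0 <= (u - low s t) / p /\ (u - low s t) / p < 1.
  move=> h1 h2; rewrite divr_ge0// ?subr_ge0//; split=> //.
  by rewrite ltr_pdivrMr// mul1r ltrBlDl.
have equ : (low s t + p * a' <= u < low s t + p * a' + p * w') =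
    (a' <= (u - low s t) / p < a' + w').
  rewrite ler_pdivlMr// ltr_pdivrMr// lerBrDl ltrBlDl mulrDl addrA.
  by rewrite (mulrC p a') (mulrC p w').
split.
  move=> [/andP[h1 h2] hc]; have [v0 v1] := Hu' h1 h2.
  by rewrite equ; apply/(Ha' _ v0 v1).
move=> h; have [h1 h2] : low s t <= u /\ u < low s t + p.
  case/andP: h => h1 h2; split.
    by apply: le_trans h1; rewrite lerDl mulr_ge0.
  by apply: lt_le_trans h2 _; rewrite -addrA lerD2l -mulrDr ler_piMr.
have [v0 v1] := Hu' h1 h2.
by rewrite h1 h2; split=> //; apply/(Ha' _ v0 v1); rewrite -equ.
Qed.

Let decode01 (s : S) (u : R) : paths :=
  decode s (if (0 <= u) && (u < 1) then u else 0).

Let I01 : set (measurableTypeR R) := `[0, 1[.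

Let mI01 : measurable I01. Proof. exact: measurable_itv. Qed.

Let decode01_cyl s n x :
  measurable (decode01 s @^-1` cylinder n x) /\
  lebesgue_measure (decode01 s @^-1` cylinder n x `&` I01) =
    ((x 0 == s)%:R * \prod_(i < n) trans D (x i) (x i.+1))%:E.
Proof.
have [x0|x0] := eqVneq (x 0%N) s; last first.
  have -> : decode01 s @^-1` cylinder n x = set0.
    by apply/seteqP; split=> // u /= /(_ 0%N isT) /= e; move: x0; rewrite -e eqxx.
  by rewrite set0I measure0 mul0r.
have [a [a0 a1 Ha]] := decode_cyl n x0.
rewrite mul1r; set w := \prod_(i < n) _ in a1 Ha *.
have w0 : 0 <= w by apply: prodr_ge0 => i _; exact: trans_ge0.
have E1 : decode01 s @^-1` cylinder n x `&` I01 = `[a, a + w[%classic.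
  apply/seteqP; split=> u /=; rewrite /I01 /= !in_itv /= /decode01.
    by move=> [+ /andP[u0 u1]]; rewrite u0 u1 => /(Ha _ u0 u1).
  move=> /[dup] h /andP[h1 h2].
  have u0 : 0 <= u := le_trans a0 h1.
  have u1 : u < 1 := lt_le_trans h2 a1.
  by rewrite u0 u1; split=> //; apply/(Ha _ u0 u1).
split; last first.
  rewrite E1 lebesgue_measure_itv/= lte_fin ltrDl -EFinD addrAC subrr add0r.
  by case: ltP => // w0'; congr EFin; apply/eqP; rewrite eq_le w0 w0'.
rewrite -(setUIDK (decode01 s @^-1` cylinder n x) I01).
apply: measurableU; first by rewrite E1; exact: measurable_itv.
have -> : decode01 s @^-1` cylinder n x `\` I01 =
    if `[< cylinder n x (decode s 0) >] then ~` I01 else set0.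
  apply/seteqP; split=> u /=.
    move=> [h nI]; have nu : ((0 <= u) && (u < 1)) = false.
      by apply/negbTE/negP => u01; apply: nI; rewrite /I01/= in_itv.
    by move: h; rewrite /decode01 nu => h; rewrite asboolT.
  case: ifP => // /asboolP h nI; split=> //.
  have nu : ((0 <= u) && (u < 1)) = false.
    by apply/negbTE/negP => u01; apply: nI; rewrite /I01/= in_itv.
  by rewrite /decode01 nu.
by case: ifP => _; [exact: measurableC | exact: measurable0].
Qed.

Let measurable_decode01 s :
  measurable_fun [set: measurableTypeR R] (decode01 s).
Proof.
have := @measurability _ _ (measurableTypeR R) paths setT (decode01 s) cylinders.
apply=> //.
by move=> _ [_ [n [x ->]] <-]; rewrite setTI; exact: (decode01_cyl s n x).1.
Qed.

Lemma path_measure_exists (s : S) : exists P, is_path_measure s P.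
Proof.
pose f : {mfun measurableTypeR R >-> paths} := HB.pack (decode01 s)
  (isMeasurableFun.Build _ _ _ _ _ (measurable_decode01 s)).
pose nu : {measure set (measurableTypeR R) -> \bar R} :=
  mrestr (@lebesgue_measure R) mI01.
have nu1 : nu setT = 1%E.
  by rewrite /nu/= /mrestr setTI lebesgue_measure_itv/= lte_fin ltr01 oppr0 adde0.
pose nup : probability (measurableTypeR R) R :=
  HB.pack (Measure.sort nu) (Measure_isProbability.Build _ _ _ nu nu1).
exists (distribution nup f) => n x.
exact: (decode01_cyl s n x).2.
Qed.

Definition path_measure (s : S) : probability paths R :=
  projT1 (cid (path_measure_exists s)).

Lemma path_measureP (s : S) : is_path_measure s (path_measure s).
Proof. exact: projT2 (cid (path_measure_exists s)). Qed.

Definition eventually_in (A : {set S}) : set paths :=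
  [set w | exists i, w i \in A].

Definition always_upto (k : nat) (A : {set S}) : set paths :=
  [set w | forall i, (i <= k)%N -> w i \in A].

(* [Some k] is a finite step bound and [None] is the bound oo; the sum stops at
   [min ({i | w i \in G} `|` {k})]. The value [0] is used only when this set is
   empty, i.e. for the bound oo on paths that never reach [G]. *)
Definition stops (G : {set S}) (k : option nat) (w : paths) (i : nat) : bool :=
  (w i \in G) || (Some i == k).

Definition reach_reward (G : {set S}) (k : option nat) (w : paths) : R :=
  if pselect (exists i, stops G k w i) is left ex
  then \sum_(i < ex_minn ex) reward D (w i) else 0.

End path_space.

Arguments cylinder {R S} D n x.
Arguments eventually_in {R S} D A.
Arguments always_upto {R S} D k A.
Arguments reach_reward {R S} D G k w.

(* Main.v *)
Require Import Defs.
From HB Require Import structures.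
From mathcomp Require Import all_boot all_order all_algebra.
From mathcomp Require Import all_classical all_reals all_analysis.
From mathcomp Require Import measurable_realfun.

(* Let [v s] be the expected reward from [s], [r s] the [k]-bounded one, and
   [p s] the probability of avoiding [G] for [k] steps. Splitting at time [k]
   gives [v s = r s + E_s (v (w k); G avoided up to k)]. At a minimiser [s] of
   [v] outside [G] this yields [v s >= r s + p s * v s], hence
   [v >= r s / (1 - p s)] outside [G], and inserting this bound in the equation
   at the initial state gives the lower bound of the theorem; the upper bound is
   the lower bound for [- r] and [- v]. Dominated convergence, with the maximal
   absolute reward times the hitting time of [G] as majorant, shows that [v] is
   finite and is the limit of the bounded rewards. *)

Set Implicit Arguments.
Unset Strict Implicit.
Unset Printing Implicit Defensive.

Import Order.TTheory GRing.Theory Num.Theory.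
Import numFieldNormedType.Exports.

Local Open Scope classical_set_scope.
Local Open Scope ring_scope.
Local Open Scope ereal_scope.

(** Finite additivity over the fibres of [X]. Measurability is asked of the pieces, which the uses
    below rewrite as events known to be measurable. *)
Lemma measure_fin_partition (d : measure_display) (T : measurableType d)
    (R : realType) (I : finType) (mu : probability T R) (X : T -> I)
    (A : set T) :
  (forall i, measurable (A `&` [set w | X w = i])) ->
  mu A = \sum_i mu (A `&` [set w | X w = i]).
Proof.
move=> mAX.
have -> : mu A = mu (\bigcup_(i in [set: I]) (A `&` [set w | X w = i])).
  congr (mu _); apply/seteqP; split=> [w Aw|w [i _ []]//].
  by exists (X w).
rewrite measure_fin_bigcup; first last.
- by move=> i _; exact: mAX.
- by move=> i j _ _ [w [[_ <-] [_ <-]]].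
- exact: finite_finset.
rewrite (@fsbigE _ _ _ _ _ (index_enum I)) ?index_enum_uniq//.
- by apply: eq_bigl => i; rewrite in_setT.
- by move=> i _; rewrite mem_index_enum.
Qed.

(** * Finite-horizon expectations of the chain killed in [G] *)

Section taboo.
Context (R : realType) (S : finType) (D : markov_chain R S) (G : {set S}).
Local Open Scope ring_scope.
Implicit Types (f g : S -> R) (s t : S) (n : nat).

(* [taboo n f s] is the expectation under [s] of [f (w n)] restricted to the
   paths [w] that avoid [G] up to time [n]. *)
Fixpoint taboo n f s : R :=
  (s \notin G)%:R *
  (if n is m.+1 then \sum_t trans D s t * taboo m f t else f s).

Lemma taboo_in n f s : s \in G -> taboo n f s = 0.
Proof. by move=> sG; case: n => [|n] /=; rewrite sG mul0r. Qed.

(** Chapman-Kolmogorov for the killed chain. On the right, time [m] is tested twice, harmlessly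
    since the test is idempotent. *)
Lemma tabooD m n f s : taboo (m + n) f s = taboo m (taboo n f) s.
Proof.
elim: m s => [|m IH] s /=; last by under eq_bigr do rewrite IH.
have [sG|sG] := boolP (s \in G); first by rewrite taboo_in// mul0r.
by rewrite mul1r.
Qed.

(** The coefficients are the entries of the [n]-th power of the transition matrix restricted to the
    complement of [G]. *)
Lemma taboo_lin n f s :
  taboo n f s = \sum_t f t * taboo n (fun r => (r == t)%:R) s.
Proof.
elim: n s => [|n IH] s /=.
  rewrite (bigD1 s)//= big1 => [|t ts]; first by rewrite eqxx mulr1 addr0 mulrC.
  by rewrite eq_sym (negbTE ts) !mulr0.
under eq_bigr do rewrite IH mulr_sumr.
rewrite exchange_big mulr_sumr; apply: eq_bigr => t _ /=.
rewrite [RHS]mulrCA; congr (_ * _); rewrite mulr_sumr.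
by apply: eq_bigr => r _; rewrite mulrCA.
Qed.

Lemma taboo_scale n (a : R) f s :
  taboo n (fun r => a * f r) s = a * taboo n f s.
Proof.
by rewrite !(taboo_lin n _ s) mulr_sumr; apply: eq_bigr => t _; rewrite mulrA.
Qed.

Lemma taboo_sum n (I : Type) (r : seq I) (f : I -> S -> R) s :
  taboo n (fun t => \sum_(i <- r) f i t) s = \sum_(i <- r) taboo n (f i) s.
Proof.
under eq_bigr do rewrite taboo_lin.
rewrite taboo_lin exchange_big/=.
by apply: eq_bigr => t _; rewrite mulr_suml.
Qed.

(** Only paths outside [G] at time [n] count, so comparing there suffices; [renewal_ge] minimises
    over just these states. *)
Lemma taboo_le n f g s : (forall t, t \notin G -> f t <= g t) ->
  taboo n f s <= taboo n g s.
Proof.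
move=> fg; elim: n s => [|n IH] s /=; last first.
  apply: ler_wpM2l => //; apply: ler_sum => t _.
  by apply: ler_wpM2l => //; exact: trans_ge0.
by have [sG|/fg] := boolP (s \in G); rewrite ?mul0r ?mul1r.
Qed.

Lemma taboo_ge0 n f s : (forall t, 0 <= f t) -> 0 <= taboo n f s.
Proof.
(* Zero is written [0 * 0] so that [taboo_scale] applies. *)
move=> f0; have <- : taboo n (fun=> 0 * 0) s = 0 by rewrite taboo_scale mul0r.
by apply: taboo_le => t _; rewrite mul0r.
Qed.

(** * Survival probabilities: avoiding [G] up to a given time *)

Definition survival n s : R := taboo n (fun=> 1) s.

Lemma survival_ge0 n s : 0 <= survival n s.
Proof. by apply: taboo_ge0 => _; exact: ler01. Qed.

Lemma survival_le1 n s : survival n s <= 1.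
Proof.
rewrite /survival; elim: n s => [|n IH] s /=.
  by rewrite mulr1 lern1 leq_b1.
apply: (@le_trans _ _ (1 * 1)); last by rewrite mulr1.
apply: ler_pM => //.
- by apply: sumr_ge0 => t _; rewrite mulr_ge0 ?trans_ge0 ?survival_ge0.
- by rewrite lern1 leq_b1.
rewrite -[leRHS](trans_sum1 D s); apply: ler_sum => t _.
exact: ler_piMr (trans_ge0 _ _ _) (IH t).
Qed.

Lemma taboo_cst n (a : R) s : taboo n (fun=> a) s = a * survival n s.
Proof. by rewrite /survival -taboo_scale mulr1. Qed.

(* If [U] maximises [fun s => \sum_(i < N + k) survival i s], then splitting
   off the first [k] terms gives [U <= k + survival k s * U]. *)
Lemma survival_summable k : (forall s, s \notin G -> survival k s < 1) ->
  exists C, forall N s, \sum_(i < N) survival i s <= C.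
Proof.
move=> k_leaves; pose c s := k%:R / (1 - survival k s).
have c0 s : 0 <= c s by rewrite divr_ge0// subr_ge0 survival_le1.
(* [c s] bounds the sum at a maximiser [s] outside [G]; as the maximiser may vary with [N], the
   witness adds up all [c s]. *)
exists (\sum_s c s) => N s0.
pose U s := \sum_(i < k + N) survival i s.
have UE s : U s = \sum_(i < k) survival i s +
    taboo k (fun t => \sum_(i < N) survival i t) s.
  rewrite /U big_split_ord/=; congr (_ + _); rewrite taboo_sum.
  by apply: eq_bigr => i _; rewrite /survival tabooD.
have lN s : \sum_(i < N) survival i s <= U s.
  rewrite /U addnC big_split_ord/= lerDl sumr_ge0// => i _.
  exact: survival_ge0.
apply: (le_trans (lN s0)).
have [s _ smax] := @arg_maxP _ _ _ s0 xpredT U erefl.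
apply: (le_trans (smax s0 erefl)).
have [sG|sG] := boolP (s \in G).
  by rewrite /U big1 ?sumr_ge0// => i _; exact: taboo_in.
apply: (@le_trans _ _ (c s)); last first.
  by rewrite (bigD1 s)//= lerDl sumr_ge0.
rewrite ler_pdivlMr ?subr_gt0 ?k_leaves// mulrBr mulr1 lerBlDr {1}UE lerD//.
  rewrite -[leRHS](_ : \sum_(i < k) 1 = _); last by rewrite sumr_const card_ord.
  by apply: ler_sum => i _; exact: survival_le1.
rewrite -taboo_cst; apply: taboo_le => t _.
by apply: (le_trans (lN t)); exact: smax.
Qed.

(** * Renewal inequalities *)

(** The witness [s] minimises [v], not the quotient; one such state suffices, since the minimum of
    the quotients lies below the quotient at [s]. *)
Lemma renewal_ge k (r v : S -> R) s0 :
  (forall s, s \notin G -> survival k s < 1) ->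
  (forall s, v s = r s + taboo k v s) ->
  s0 \notin G -> exists2 s, s \notin G &
  r s0 + survival k s0 * (r s / (1 - survival k s)) <= v s0.
Proof.
move=> k_leaves vE s0G.
have [s sG smin] := @arg_minP _ _ _ s0 [pred s | s \notin G] v s0G.
exists s => //; rewrite vE lerD2l.
apply: (@le_trans _ _ (survival k s0 * v s)).
  apply: ler_wpM2l; first exact: survival_ge0.
  rewrite ler_pdivrMr ?subr_gt0 ?k_leaves// mulrBr mulr1 lerBrDr {2}vE lerD2l.
  by rewrite -taboo_cst; apply: taboo_le.
by rewrite mulrC -taboo_cst; exact: taboo_le.
Qed.

Lemma renewal_le k (r v : S -> R) s0 :
  (forall s, s \notin G -> survival k s < 1) ->
  (forall s, v s = r s + taboo k v s) ->
  s0 \notin G -> exists2 s, s \notin G &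
  v s0 <= r s0 + survival k s0 * (r s / (1 - survival k s)).
Proof.
move=> k_leaves vE s0G.
have [|s sG h] :=
  @renewal_ge k (fun s => - r s) (fun s => - v s) s0 k_leaves _ s0G.
  move=> s; rewrite {1}vE opprD; congr (_ + _).
  by rewrite -mulN1r -taboo_scale; under eq_fun do rewrite mulN1r.
by exists s => //; move: h; rewrite mulNr mulrN -opprD lerN2.
Qed.

End taboo.

(** * Measurability of path events *)

Section path_events.
Context (R : realType) (S : finType) (D : markov_chain R S) (G : {set S}).
Implicit Types (f : S -> R) (s t : S) (m n : nat).

Let Pr := path_measure D.

Lemma measurable_cylinder n (x : nat -> S) :
  measurable (cylinder D n x : set (paths D)).
Proof. by apply: sub_sigma_algebra; exists n, x. Qed.

(** A union of cylinders over words of length [n.+1] ending in [t]; indexing by finite functions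
    makes the union finite. *)
Lemma measurable_coord n t : measurable ([set w | w n = t] : set (paths D)).
Proof.
have -> : [set w | w n = t] = \bigcup_(x in [set x : {ffun 'I_n.+1 -> S} |
    x ord_max = t]) (cylinder D n (fun i => x (inord i)) : set (paths D)).
  apply/seteqP; split=> [w /= wnt|w /= [x /= xt]].
    exists [ffun i : 'I_n.+1 => w i]; first by rewrite /= ffunE.
    by move=> i ilen; rewrite ffunE inordK.
  move=> /(_ n (leqnn n)) ->; rewrite -xt; congr (x _).
  by apply: val_inj; rewrite /= inordK.
apply: fin_bigcup_measurable => [|x _]; first exact: finite_finset.
exact: measurable_cylinder.
Qed.

Lemma measurable_coord_in n (A : {set S}) :
  measurable ([set w | w n \in A] : set (paths D)).
Proof.
have -> : [set w | w n \in A] =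
    \bigcup_(t in [set t | t \in A]) ([set w | w n = t] : set (paths D)).
  by apply/seteqP; split=> [w /= wA|w /= [t tA ->]//]; exists (w n).
apply: fin_bigcup_measurable => [|t _]; first exact: finite_finset.
exact: measurable_coord.
Qed.

Lemma measurable_always_upto n (A : {set S}) : measurable (always_upto D n A).
Proof.
have -> : always_upto D n A =
    \bigcap_(i in [set i | (i <= n)%N]) ([set w | w i \in A] : set (paths D)).
  by apply/seteqP; split.
by apply: bigcap_measurable => [|i _]; [exists 0%N|exact: measurable_coord_in].
Qed.

Lemma measurable_eventually_in (A : {set S}) : measurable (eventually_in D A).
Proof.
have -> : eventually_in D A = \bigcup_i ([set w | w i \in A] : set (paths D)).
  by apply/seteqP; split=> [w [i wi]|w [i _ wi]]; exists i.
by apply: bigcup_measurable => i _; exact: measurable_coord_in.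
Qed.

(** * The Markov property for paths avoiding [G] *)

(** The window has a free start [m] so that an induction can shorten it from the left while
    lengthening a cylinder. *)
Definition avoid_between m n t : set (paths D) :=
  [set w | (forall i, (m <= i <= m + n)%N -> w i \notin G) /\ w (m + n)%N = t].

Lemma measurable_avoid_between m n t : measurable (avoid_between m n t).
Proof.
have -> : avoid_between m n t =
    \bigcap_(i in [set i | (m <= i <= m + n)%N])
      ([set w | w i \in ~: G] : set (paths D)) `&` [set w | w (m + n)%N = t].
  by apply/seteqP; split=> w /= [h wt]; split=> // i /h; rewrite /= inE.
apply: measurableI; last exact: measurable_coord.
apply: bigcap_measurable => [|i _]; last exact: measurable_coord_in.
by exists m; rewrite /= leqnn leq_addr.
Qed.

(** Markov property at time [m]. Splitting by the state at time [m.+1] gives longer cylinders with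
    shorter windows; the extra factor of the cylinder formula is the weight in the recursion of
    [taboo]. *)
Lemma path_measure_cylinder_avoid s m n t (x : nat -> S) :
  Pr s (cylinder D m x `&` avoid_between m n t) =
  Pr s (cylinder D m x) * (taboo D G n (fun r => (r == t)%:R) (x m))%:E.
Proof.
elim: n m x => [|n IH] m x /=.
  have [xG|xG] := boolP (x m \in G).
    rewrite mul0r mule0 -(measure0 (Pr s)); congr (Pr s _).
    apply/seteqP; split=> // w /= [/(_ m (leqnn m)) wm [/(_ m)]].
    by rewrite wm xG addn0 leqnn => /(_ isT).
  rewrite mul1r; have [xt|xt] := eqVneq (x m) t.
    rewrite mule1; congr (Pr s _); apply/seteqP; split=> [w [//]|w cw].
    split=> //.
    split=> [i|]; rewrite addn0; last by rewrite cw.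
    by rewrite -eqn_leq => /eqP <-; rewrite cw.
  rewrite mule0 -(measure0 (Pr s)); congr (Pr s _).
  apply/seteqP; split=> // w /= [/(_ m (leqnn m)) wm [_]].
  by rewrite addn0 wm; exact/eqP.
have [xG|xG] := boolP (x m \in G).
  rewrite mul0r mule0 -(measure0 (Pr s)); congr (Pr s _).
  apply/seteqP; split=> // w /= [/(_ m (leqnn m)) wm [/(_ m)]].
  by rewrite wm xG leqnn leq_addr => /(_ isT).
rewrite mul1r.
(* The prefix [x] up to time [m], prolonged by [r]. *)
pose y r i := if (i <= m)%N then x i else r.
have yS r : y r m.+1 = r by rewrite /y ltnn.
have cylE r :
    cylinder D m x `&` avoid_between m n.+1 t `&` [set w | w m.+1 = r] =
    cylinder D m.+1 (y r) `&` avoid_between m.+1 n t.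
  apply/seteqP; split=> w /=.
    move=> [[cw [wG wt]] wr]; split.
      move=> i; rewrite leq_eqVlt => /orP[/eqP -> |]; first by rewrite yS.
      by rewrite ltnS /y => im; rewrite im cw.
    split; last by rewrite addSnnS.
    by move=> i /andP[mi ilen]; apply: wG; rewrite (ltnW mi) -addSnnS.
  move=> [cw [wG wt]]; split; last by rewrite cw// yS.
  have cwm i : (i <= m)%N -> w i = x i.
    by move=> im; rewrite cw ?leqW// /y im.
  split; first exact: cwm.
  split; last by rewrite -addSnnS.
  move=> i /andP[]; rewrite leq_eqVlt => /orP[/eqP <- _|mi ilen].
    by rewrite cwm.
  by apply: wG; rewrite mi addSnnS.
rewrite [LHS](@measure_fin_partition _ _ _ _ _ (fun w : paths D => w m.+1));
  last first.
  move=> r; rewrite cylE.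
  apply: measurableI; first exact: measurable_cylinder.
  exact: measurable_avoid_between.
rewrite -sumEFin ge0_sume_distrr; last first.
  move=> r _; rewrite lee_fin mulr_ge0 ?trans_ge0//.
  by apply: taboo_ge0 => u; rewrite ler0n.
apply: eq_bigr => r _; rewrite cylE IH yS.
rewrite !path_measureP big_ord_recr/= yS -!EFinM !mulrA /y leq0n leqnn.
congr (_ * _ * _ * _)%:E; apply: eq_bigr => i _.
by rewrite ltn_ord ltnW// ltn_ord.
Qed.

Lemma path_measure_avoid s n t :
  Pr s (avoid_between 0 n t) = (taboo D G n (fun r => (r == t)%:R) s)%:E.
Proof.
have cylE r : avoid_between 0 n t `&` [set w | w 0%N = r] =
    cylinder D 0 (fun=> r) `&` avoid_between 0 n t.
  rewrite setIC; congr (_ `&` _); apply/seteqP; split=> w /=; last exact.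
  by move=> wr i; rewrite leqn0 => /eqP ->.
rewrite [LHS](@measure_fin_partition _ _ _ _ _ (fun w : paths D => w 0%N));
  last first.
  move=> r; rewrite cylE.
  apply: measurableI; first exact: measurable_cylinder.
  exact: measurable_avoid_between.
under eq_bigr do rewrite cylE path_measure_cylinder_avoid
  path_measureP big_ord0 mulr1.
rewrite (bigD1 s)//= eqxx mul1e big1 ?adde0// => r /negbTE ->.
by rewrite mul0e.
Qed.

(** * Expectations restricted to avoiding paths *)

Definition stay_value n f (w : paths D) : R :=
  (\1_(always_upto D n (~: G)) w * f (w n))%R.

(** Only [t = w n] can contribute. As a finite combination of indicators, [stay_value] is integrated
    by linearity. *)
Lemma stay_valueE n f w :
  (stay_value n f w)%:E = \sum_t (f t)%:E * (\1_(avoid_between 0 n t) w)%:E.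
Proof.
rewrite /stay_value (bigD1 (w n))//= big1 ?adde0; last first.
  move=> t tw; rewrite indicE memNset ?mule0// => -[_ /= wt].
  by rewrite wt eqxx in tw.
rewrite EFinM muleC; congr (_ * _%:E).
rewrite !indicE; congr (nat_of_bool _)%:R.
apply/idP/idP => /set_mem h; apply/mem_set.
  by split=> // i /= /h; rewrite inE.
by move=> i ilen; rewrite inE; apply: h.1.
Qed.

Lemma integrable_stay_value s n f :
  (Pr s).-integrable setT (fun w => (stay_value n f w)%:E).
Proof.
apply: eq_integrable (fun w _ => esym (stay_valueE n f w)) _ => //.
apply: integrable_sum => // t _; apply: integrableZl => //.
by apply: integrable_indic; exact: measurable_avoid_between.
Qed.

Lemma integral_stay_value s n f :
  \int[Pr s]_w (stay_value n f w)%:E = (taboo D G n f s)%:E.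
Proof.
have i1 t : (Pr s).-integrable setT (fun w => (\1_(avoid_between 0 n t) w)%:E).
  by apply: integrable_indic; exact: measurable_avoid_between.
under eq_integral do rewrite stay_valueE.
rewrite integral_sum//; last by move=> t; apply: integrableZl.
rewrite taboo_lin -sumEFin; apply: eq_bigr => t _.
rewrite integralZl// integral_indic//; last exact: measurable_avoid_between.
by rewrite setIT EFinM; congr (_ * _); exact: path_measure_avoid.
Qed.

Lemma path_measure_always_upto s n :
  Pr s (always_upto D n (~: G)) = (survival D G n s)%:E.
Proof.
rewrite /survival -integral_stay_value.
rewrite -[in LHS](setIT (always_upto _ _ _)) -integral_indic//.
  by apply: eq_integral => w _; rewrite /stay_value mulr1.
exact: measurable_always_upto.
Qed.


(** * Accumulated rewards *)

(** The indicators in the terms replace the random stopping time by a fixed number of terms, so that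
    expectations are taken termwise. *)
Definition reward_sum N (w : paths D) : R :=
  (\sum_(i < N) stay_value i (reward D) w)%R.

(** [J] is the hitting time of [G] capped at [N]: terms before [J] have indicator 1, and later ones,
    if any, have indicator 0. *)
Lemma reward_sum_stop J N (w : paths D) : (J <= N)%N ->
  (forall i, (i < J)%N -> w i \notin G) -> (w J \in G) || (J == N) ->
  reward_sum N w = (\sum_(i < J) reward D (w i))%R.
Proof.
move=> JN wG wJ; rewrite /reward_sum -(subnKC JN) big_split_ord/=.
rewrite [X in (_ + X)%R]big1 ?addr0 => [|i _].
  apply: eq_bigr => i _; rewrite /stay_value indicE mem_set ?mul1r// => j ji.
  by rewrite inE wG// (leq_ltn_trans ji).
have {}wJ : w J \in G.
  by case/orP: wJ => // /eqP JE; case: i => i /=; rewrite JE subnn.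
rewrite /stay_value indicE memNset ?mul0r// => /(_ J (leq_addr _ _)).
by rewrite inE wJ.
Qed.

Lemma reach_reward_bounded N : reach_reward D G (Some N) = reward_sum N.
Proof.
apply/funext => w; rewrite /reach_reward; case: pselect => [ex|[]]; last first.
  by exists N; rewrite /stops eqxx orbT.
case: ex_minnP => J wJ Jmin; apply/esym/reward_sum_stop => //.
  by apply: Jmin; rewrite /stops eqxx orbT.
move=> i iJ; apply/negP => wi; move: (Jmin i).
by rewrite /stops wi => /(_ isT); rewrite leqNgt iJ.
Qed.

Lemma reach_reward_never (w : paths D) :
  ~ eventually_in D G w -> reach_reward D G None w = 0%R.
Proof.
rewrite /reach_reward => nw; case: pselect => // -[i wi]; exfalso.
by apply: nw; exists i; move: wi; rewrite /stops orbF.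
Qed.

Lemma reach_reward_near (w : paths D) : eventually_in D G w ->
  \forall N \near \oo, reward_sum N w = reach_reward D G None w.
Proof.
move=> [i0 wi0]; rewrite /reach_reward; case: pselect => [ex|[]]; last first.
  by exists i0; rewrite /stops wi0.
case: ex_minnP => J wJ Jmin; exists J => // N /= JN.
apply: reward_sum_stop => //; last by move: wJ; rewrite /stops orbF => ->.
move=> i iJ; apply/negP => wi; move: (Jmin i).
by rewrite /stops wi => /(_ isT); rewrite leqNgt iJ.
Qed.

Lemma integrable_reward_sum s N :
  (Pr s).-integrable setT (fun w => (reward_sum N w)%:E).
Proof.
under eq_fun do rewrite -sumEFin.
by apply: integrable_sum => // i _; exact: integrable_stay_value.
Qed.

Lemma integral_reward_sum s N : \int[Pr s]_w (reward_sum N w)%:E =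
  (\sum_(i < N) taboo D G i (reward D) s)%:E.
Proof.
under eq_integral do rewrite -sumEFin.
rewrite integral_sum//; last by move=> i; exact: integrable_stay_value.
by rewrite -sumEFin; apply: eq_bigr => i _; exact: integral_stay_value.
Qed.

(** A pointwise limit of measurable functions. The indicator forces convergence to the default value
    0 on paths that never reach [G]. *)
Lemma measurable_reach_reward :
  measurable_fun [set: paths D]
    (EFin \o reach_reward D G None).
Proof.
apply: (@emeasurable_fun_cvg _ _ _ _
  (fun N w => (\1_(eventually_in D G) w)%:E * (reward_sum N w)%:E)).
  move=> N; apply: emeasurable_funM; last first.
    exact: measurable_int (integrable_reward_sum (init D) N).
  apply/measurable_EFinP; apply: measurable_indic.
  exact: measurable_eventually_in.
move=> w _ /=; have [ew|nw] := pselect (eventually_in D G w).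
  apply: cvg_near_cst; apply: filterS (reach_reward_near ew) => N <-.
  by rewrite indicE mem_set// mul1e.
apply: cvg_near_cst; apply: nearW => N.
by rewrite indicE memNset// mul0e reach_reward_never.
Qed.

(** * Almost sure reachability and passage to the limit *)

Section leaves.
Context (k : nat)
  (k_leaves : forall s, s \notin G -> (survival D G k s < 1)%R).

Lemma survival_cvg0 s : survival D G n s @[n --> \oo] --> (0 : R)%R.
Proof.
have [C UC] := survival_summable k_leaves.
rewrite -[X in X @ _ --> _]/(survival D G ^~ s).
apply: cvg_series_cvg_0; apply: nondecreasing_is_cvgn.
  apply: nondecreasing_series => i _ _; exact: survival_ge0.
by exists C => _ [N _ <-]; rewrite /series/= big_mkord.
Qed.

(** The event lies in that of survival up to [n], for every [n]. *)
Lemma path_measure_never s : Pr s (~` eventually_in D G) = 0.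
Proof.
apply/eqP; rewrite eq_le measure_ge0 andbT.
have h n : Pr s (~` eventually_in D G) <= (survival D G n s)%:E.
  rewrite -path_measure_always_upto; apply: le_measure; rewrite ?inE.
  - by apply: measurableC; exact: measurable_eventually_in.
  - exact: measurable_always_upto.
  - by move=> w nw i _; rewrite inE; apply/negP => wi; apply: nw; exists i.
apply: (@cvge_ge _ \oo _ _ (fun n => (survival D G n s)%:E)).
  exact: nearW.
by apply: cvg_EFin; [exact: nearW | exact: survival_cvg0].
Qed.

Lemma reach_reward_cvg s :
  (Pr s).-integrable setT (fun w => (reach_reward D G None w)%:E) /\
  (\sum_(i < N) taboo D G i (reward D) s)%:E @[N --> \oo] -->
    \int[Pr s]_w (reach_reward D G None w)%:E.
Proof.
pose M := (\sum_t `|reward D t|)%R.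
have rM t : (`|reward D t| <= M)%R by rewrite /M (bigD1 t)//= lerDl sumr_ge0.
have M0 : (0 <= M)%R by rewrite sumr_ge0.
(* [M] times the hitting time of [G], as a series with integrable terms. *)
pose g (w : paths D) := \sum_(0 <= i <oo) (stay_value i (fun=> M) w)%:E.
have sM0 i (w : paths D) : 0 <= (stay_value i (fun=> M) w)%:E.
  by rewrite lee_fin mulr_ge0// indicE.
have ms i : measurable_fun [set: paths D]
    (EFin \o @stay_value i (fun=> M)).
  exact: measurable_int (integrable_stay_value s i _).
have ig : (Pr s).-integrable setT g.
  apply/integrableP; split.
    apply: (@ge0_emeasurable_sum _ _ _ setT
      (fun i => EFin \o @stay_value i (fun=> M)) xpredT).
      by move=> i w _ _; exact: sM0.
    by move=> i _; exact: ms.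
  under eq_integral do rewrite gee0_abs ?nneseries_ge0//.
  (* Integrating termwise gives the series of [M * survival D G i s], with bounded partial sums. *)
  rewrite integral_nneseries//.
  have [C UC] := survival_summable k_leaves.
  apply: (@le_lt_trans _ _ (M * C)%:E); last exact: ltry.
  apply: lime_le.
    by apply: is_cvg_nneseries => i _ _; exact: integral_ge0.
  apply: nearW => N; under eq_bigr do rewrite integral_stay_value.
  rewrite sumEFin lee_fin big_mkord; under eq_bigr do rewrite taboo_cst.
  by rewrite -mulr_sumr ler_wpM2l.
have [] := @dominated_convergence _ _ _ (Pr s) setT measurableT
  (fun N w => (reward_sum N w)%:E) (fun w => (reach_reward D G None w)%:E) g.
- by move=> N; exact: measurable_int (integrable_reward_sum s N).
- exact: measurable_reach_reward.
- exists (~` eventually_in D G); split.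
  + by apply: measurableC; exact: measurable_eventually_in.
  + exact: path_measure_never.
  + move=> w /= nc ew; apply: nc => _; apply: cvg_near_cst.
    by apply: filterS (reach_reward_near ew) => N ->.
- exact: ig.
- apply: aeW => w N _; rewrite abse_EFin.
  apply: (@le_trans _ _ (\sum_(0 <= i < N) (stay_value i (fun=> M) w)%:E)).
    rewrite big_mkord sumEFin lee_fin; apply: le_trans (ler_norm_sum _ _ _) _.
    apply: ler_sum => i _; rewrite /stay_value normrM ger0_norm; last first.
      by rewrite indicE.
    by rewrite ler_wpM2l// indicE.
  by apply: nneseries_lim_ge => i _ _; exact: sM0.
move=> irew _ cv; split=> //.
by under eq_cvg do rewrite -integral_reward_sum.
Qed.

(** Limit of the finite-horizon identity [uE], which splits [N + k] steps at time [k] by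
    [tabooD]. *)
Lemma reach_reward_renewal s :
  let v s := fine (\int[Pr s]_w (reach_reward D G None w)%:E) in
  v s = (\sum_(i < k) taboo D G i (reward D) s + taboo D G k v s)%R.
Proof.
move=> v; pose u N s := (\sum_(i < N) taboo D G i (reward D) s)%R.
have uv t : u N t @[N --> \oo] --> v t.
  have [irew cv] := reach_reward_cvg t.
  have fin := integrable_fin_num measurableT irew.
  by move: cv; rewrite -(fineK fin) => /fine_cvg.
have uE N : u (N + k)%N s = (u k s + taboo D G k (u N) s)%R.
  rewrite /u addnC big_split_ord/=; congr (_ + _)%R; rewrite taboo_sum.
  by apply: eq_bigr => i _; rewrite tabooD.
have : u (N + k)%N s @[N --> \oo] --> v s by rewrite (cvg_shiftn k (u ^~ s)).
under eq_cvg do rewrite uE.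
move=> h; apply: (cvg_unique _ h) => //.
apply: cvgD; first exact: cvg_cst.
(* As a finite sum over states, [taboo] commutes with the limit. *)
rewrite taboo_lin; under eq_cvg do rewrite taboo_lin.
apply: cvg_big => [|t _]; first exact: add_continuous.
by apply: cvgM; [exact: uv | exact: cvg_cst].
Qed.

End leaves.

End path_events.

(** * Bounds on the expected reachability reward *)

Theorem theorem3 (R : realType) (S : finType) (D : markov_chain R S)
    (G : {set S}) (k : nat)
    (G_absorbing : forall s, s \in G -> absorbing D s)
    (G_reached : path_measure D (init D) (eventually_in D G) = 1)
    (k_leaves : forall s, s \in ~: G ->
      path_measure D s (always_upto D k (~: G)) < 1) :
  let Pr s := path_measure D s in
  let stay := always_upto D k (~: G) in
  let Rewk := reach_reward D G (Some k) in
  let Rew := reach_reward D G None in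
  'E_(Pr (init D))[Rewk] + Pr (init D) stay *
      \big[mine/+oo]_(s in ~: G) ('E_(Pr s)[Rewk] / (1 - Pr s stay))
    <= 'E_(Pr (init D))[Rew] /\
  'E_(Pr (init D))[Rew]
    <= 'E_(Pr (init D))[Rewk] + Pr (init D) stay *
      \big[maxe/-oo]_(s in ~: G) ('E_(Pr s)[Rewk] / (1 - Pr s stay)).
Proof.
move=> Pr stay Rewk Rew.
have PE s : Pr s stay = (survival D G k s)%:E.
  exact: path_measure_always_upto.
have leaves s : s \notin G -> (survival D G k s < 1)%R.
  by move=> sG; rewrite -lte_fin -PE k_leaves// inE.
pose r s := (\sum_(i < k) taboo D G i (reward D) s)%R.
pose v s := fine (\int[Pr s]_w (Rew w)%:E).
have rE s : 'E_(Pr s)[Rewk] = (r s)%:E.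
  by rewrite unlock /Rewk reach_reward_bounded integral_reward_sum.
have vE s : 'E_(Pr s)[Rew] = (v s)%:E.
  rewrite unlock fineK//; apply: integrable_fin_num => //.
  exact: (reach_reward_cvg leaves s).1.
have renew s : v s = (r s + taboo D G k v s)%R := reach_reward_renewal leaves s.
have qE s : s \in ~: G -> 'E_(Pr s)[Rewk] / (1 - Pr s stay) =
    (r s / (1 - survival D G k s))%R%:E.
  (* Outside [G] the denominator is positive, so the extended-real quotient is the real one. *)
  rewrite inE => sG; rewrite rE PE -EFinB inver gt_eqF ?subr_gt0 ?leaves//.
rewrite rE vE PE; set q := survival D G k (init D).
have q0 : 0 <= q%:E by rewrite lee_fin survival_ge0.
(* If the chain starts in [G], the factor [q] is 0 and both bounds collapse to [r (init D)], even
   when no state lies outside [G] and the extrema are infinite, because [0 * oo = 0]. *)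
have [iG|iG] := boolP (init D \in G).
  have -> : q = 0%R by exact: taboo_in.
  have -> : v (init D) = r (init D) by rewrite renew taboo_in// addr0.
  by rewrite !mul0e adde0.
split.
  have [s sG] := renewal_ge leaves renew iG.
  rewrite -lee_fin EFinD EFinM; apply: le_trans; apply: leeD2l.
  apply: lee_wpmul2l => //; rewrite -qE ?inE//.
  by apply: bigmin_le_cond; rewrite inE.
have [s sG] := renewal_le leaves renew iG.
rewrite -lee_fin EFinD EFinM => /le_trans; apply; apply: leeD2l.
apply: lee_wpmul2l => //; rewrite -qE ?inE//.
by apply: le_bigmax_cond; rewrite inE.
Qed.
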